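(* Let $G$ be a finite simple graph with maximum degree $\Delta\geq 3$. Let $P$ be a solvable pebble distribution on $G$, and let $U_1,\dots,U_t$ be the unit distributions obtained by restricting $P$ to its occupied vertices (so $P=\sum_i U_i$, the $U_i$ are pairwise disjoint, each $U_i$ has all its pebbles on a single vertex), indexed so that $|U_i|\leq |U_{i+1}|$. Then $$\sum_{i=1}^t\mathrm{CE}\Big(\sum_{k=1}^{i-1}U_k,\,U_i\Big)\geq \frac{|V(G)|-\sum_{i=1}^t \mathrm{cov}(U_i)}{\Delta-2}.$$
   Context: A pebble distribution is a function $V(G)\to\mathbb{Z}_{\geq0}$ with size $|P|=\sum_vP(v)$; $(P+Q)(v)=P(v)+Q(v)$; the empty sum is the zero distribution. A unit is a distribution with pebbles on only one vertex; $P,Q$ are disjoint if no vertex has pebbles under both. A pebbling move removes two pebbles from a vertex and adds one to an adjacent vertex. A vertex $v$ is $k$-reachable under $P$ if some executable sequence of pebbling moves yields at least $k$ pebbles on $v$; reachable means $1$-reachable; $P$ is solvable if every vertex is reachable. $\mathrm{cov}(P)$ is the number of vertices reachable under $P$. $\mathrm{reach}(P,v)$ is the largest $k$ with $v$ $k$-reachable; $\mathrm{exc}(P,v)=\mathrm{reach}(P,v)-1$ if $v$ is reachable and $0$ otherwise; $\mathrm{TE}(P)=\sum_v\mathrm{exc}(P,v)$; $\mathrm{CE}(P,Q)=\mathrm{TE}(P+Q)-\mathrm{TE}(P)-\mathrm{TE}(Q)$. *)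

(* Defs.v *)
From Stdlib Require Import Relations ClassicalEpsilon.
From mathcomp Require Import all_boot all_order all_algebra.
Set Implicit Arguments. Unset Strict Implicit. Unset Printing Implicit Defensive.
Import Order.TTheory GRing.Theory Num.Theory.

Definition simple_graph (T : finType) (e : rel T) : Prop :=
  symmetric e /\ irreflexive e.

Definition degree (T : finType) (e : rel T) (v : T) : nat := #|[set u | e v u]|.
Definition maxdeg (T : finType) (e : rel T) : nat := \max_(v : T) degree e v.

Definition dist (T : finType) := T -> nat.
Definition dsize (T : finType) (P : dist T) : nat := \sum_(v : T) P v.
Definition dadd (T : finType) (P Q : dist T) : dist T := fun v => P v + Q v.
Definition restr (T : finType) (P : dist T) (s : seq T) : dist T :=
  fun v => if v \in s then P v else 0.

Definition pmove (T : finType) (e : rel T) (P Q : dist T) : Prop :=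
  exists u v, e u v /\ 2 <= P u /\
    forall x, Q x = P x - 2 * (x == u) + (x == v).

Definition preach (T : finType) (e : rel T) : relation (dist T) :=
  clos_refl_trans (dist T) (@pmove T e).

Definition kreachable (T : finType) (e : rel T) (P : dist T) (v : T) (k : nat) : Prop :=
  exists Q, preach e P Q /\ k <= Q v.

Definition kreachableb (T : finType) (e : rel T) (P : dist T) (v : T) (k : nat) : bool :=
  if excluded_middle_informative (kreachable e P v k) then true else false.

Definition reachable (T : finType) (e : rel T) (P : dist T) (v : T) : Prop :=
  kreachable e P v 1.

Definition solvable (T : finType) (e : rel T) (P : dist T) : Prop :=
  forall v, reachable e P v.

Definition cov (T : finType) (e : rel T) (P : dist T) : nat :=
  #|[set v | kreachableb e P v 1]|.

(* reach(P,v): the largest k such that v is k-reachable (pebble counts never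
   increase, so k <= |P|; 0 is always reachable). *)
Definition reach (T : finType) (e : rel T) (P : dist T) (v : T) : nat :=
  \max_(k < (dsize P).+1 | kreachableb e P v k) k.

Definition exc (T : finType) (e : rel T) (P : dist T) (v : T) : nat :=
  if kreachableb e P v 1 then reach e P v - 1 else 0.

Definition TE (T : finType) (e : rel T) (P : dist T) : nat := \sum_(v : T) exc e P v.

Definition CE (T : finType) (e : rel T) (P Q : dist T) : int :=
  (TE e (dadd P Q))%:Z - (TE e P)%:Z - (TE e Q)%:Z.

(* Main.v *)
Require Import Defs.
From Stdlib Require Import Relations ClassicalEpsilon FunctionalExtensionality.
From mathcomp Require Import all_boot all_order all_algebra.
From mathcomp Require Import zify.
Set Implicit Arguments. Unset Strict Implicit. Unset Printing Implicit Defensive.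
Import Order.TTheory GRing.Theory Num.Theory.

(* The cooperation excesses telescope to TE(P) - sum_i TE(U_i), so the order of the
   units is irrelevant. With d = Delta - 2, q_w the reach under the unit at w and r(v)
   the number of units reaching v, the claim becomes: the charges
   d (exc(P, v) - sum_w exc(U_w, v)) + r(v) - 1 have nonnegative sum over the vertices.

   Say that v is on level j if q_w(v) < 2^j <= reach(P, v) for all w, and fix a cheapest
   way of bringing 2^j pebbles to v. If they all come from a single neighbour y, then y
   is on level j + 1 and v demands one unit of charge from y; this applies in particular
   to the vertices that no unit reaches, on level 0. A vertex on level j has at most Delta
   neighbours, and by minimality those contributing to it make no demand on it at that
   level: so it serves at most Delta - 1 = d + 1 demands, one of them paid for by its own
   demand if it has only one contributor, and at most d if it has two. The number of
   levels of v is bounded in terms of its excess. The one case where this fails to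
   balance, P(v) = 2^j - 1 with a single missing pebble coming from one neighbour y,
   is settled by a further demand of v on y. *)

(** * Pebbling as flows *)

Section Flow.
Variable (T : finType).
Implicit Types (mu : T -> T -> nat) (D : dist T) (u v w x y : T).

Definition inflow mu v := \sum_u mu u v.
Definition outflow mu v := \sum_w mu v w.
Definition fsize mu := \sum_u outflow mu u.

(** A relation rather than an operation, so that the same lemmas serve adding moves ([pushed_ex])
    and removing them ([pulled_ex]). *)
Definition pushed a u v mu mu' :=
  forall x y, mu' x y = mu x y + a * ((x == u) && (y == v)).

Lemma sum_delta (a : nat) (u : T) (b : bool) :
  \sum_x a * ((x == u) && b) = a * b.
Proof.
rewrite (bigD1 u) //= eqxx big1 ?addn0 // => x /negPf->.
by rewrite muln0.
Qed.

Lemma inflow_pushed a u v mu mu' x : pushed a u v mu mu' ->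
  inflow mu' x = inflow mu x + a * (x == v).
Proof.
move=> h; rewrite /inflow -(sum_delta a u (x == v)) -big_split /=.
by apply: eq_bigr => y _; rewrite h.
Qed.

Lemma outflow_pushed a u v mu mu' x : pushed a u v mu mu' ->
  outflow mu' x = outflow mu x + a * (x == u).
Proof.
move=> h; rewrite /outflow -(sum_delta a v (x == u)) -big_split /=.
by apply: eq_bigr => y _; rewrite h andbC.
Qed.

Lemma fsize_pushed a u v mu mu' : pushed a u v mu mu' ->
  fsize mu' = fsize mu + a.
Proof.
move=> h; rewrite /fsize.
have -> : \sum_x outflow mu' x = \sum_x (outflow mu x + a * ((x == u) && true)).
  by apply: eq_bigr => x _; rewrite (outflow_pushed _ h) andbT.
by rewrite big_split /= sum_delta muln1.
Qed.

Lemma pushed_ex a u v mu : exists mu', pushed a u v mu mu'.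
Proof. by exists (fun x y => mu x y + a * ((x == u) && (y == v))). Qed.

Lemma pulled_ex a u v mu : a <= mu u v -> exists mu', pushed a u v mu' mu.
Proof.
move=> h; exists (fun x y => mu x y - a * ((x == u) && (y == v))) => x y.
case: eqVneq => [->|_] /=; last by rewrite muln0 subn0 addn0.
case: eqVneq => [->|_] /=; last by rewrite muln0 subn0 addn0.
by rewrite muln1 subnK.
Qed.

Lemma fsize_inflow mu : fsize mu = \sum_v inflow mu v.
Proof. by rewrite /fsize /outflow exchange_big. Qed.

Lemma outflow_pos mu v : 0 < outflow mu v -> exists w, 0 < mu v w.
Proof.
rewrite lt0n sum_nat_eq0 negb_forall => /existsP[w] /=.
by rewrite -lt0n; exists w.
Qed.

Lemma inflow_pos mu v : 0 < inflow mu v -> exists w, 0 < mu w v.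
Proof.
rewrite lt0n sum_nat_eq0 negb_forall => /existsP[w] /=.
by rewrite -lt0n; exists w.
Qed.

Variable e : rel T.

(* A multiset of moves, without any order of execution; only the balance at each
   vertex is required. *)
Definition flow D mu :=
  (forall u v, 0 < mu u v -> e u v) /\
  (forall v, 2 * outflow mu v <= D v + inflow mu v).

Definition flow_to D v k mu := flow D mu /\ k + 2 * outflow mu v <= D v + inflow mu v.

Definition flow0 : T -> T -> nat := fun _ _ => 0.

Lemma inflow0 v : inflow flow0 v = 0.
Proof. by rewrite /inflow big1. Qed.
Lemma outflow0 v : outflow flow0 v = 0.
Proof. by rewrite /outflow big1. Qed.

Lemma flow_flow0 D : flow D flow0.
Proof. by split=> [u v //|v]; rewrite outflow0. Qed.

Lemma pushed_edge a u v mu mu' : pushed a u v mu mu' ->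
  (forall x y, 0 < mu' x y -> e x y) -> forall x y, 0 < mu x y -> e x y.
Proof. by move=> h h' x y ?; apply: h'; rewrite h; lia. Qed.

Lemma edge_pushed a u v mu mu' : pushed a u v mu mu' -> e u v ->
  (forall x y, 0 < mu x y -> e x y) -> forall x y, 0 < mu' x y -> e x y.
Proof.
move=> h euv h' x y; rewrite h.
case: eqVneq => [->|_] /=; last by rewrite muln0 addn0 => /h'.
by case: eqVneq => [->|_] //=; rewrite muln0 addn0 => /h'.
Qed.

Lemma preach_flow D Q : preach e D Q ->
  exists2 mu, (forall u v, 0 < mu u v -> e u v) &
    forall v, Q v + 2 * outflow mu v = D v + inflow mu v.
Proof.
move/clos_rt_rt1n_iff; elim => {D Q} [D|D D1 Q [u [v [euv [Du hD1]]]] _ [mu1 e1 h1]].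
  by exists flow0 => // v; rewrite inflow0 outflow0; lia.
have [mu hmu] := pushed_ex 1 u v mu1.
exists mu; first exact: edge_pushed hmu euv e1.
move=> x; rewrite (inflow_pushed _ hmu) (outflow_pushed _ hmu).
have := h1 x; have := hD1 x.
by case: eqVneq => [->|_] /=; lia.
Qed.

(** A flow can be put in order greedily: any move of the flow whose source holds two pebbles is
    executed, and induction on the number of moves finishes. *)
Lemma flow_kreachable D v k mu : flow_to D v k mu -> kreachable e D v k.
Proof.
have [n] := ubnP (fsize mu); elim: n => // n IH in D mu *.
move=> ltn [[emu bmu] hk].
case: (boolP [exists u, (0 < outflow mu u) && (2 <= D u)]) => [|hno].
  case/existsP => u /andP[/outflow_pos[w muw] Du].
  have [mu' hmu] := pulled_ex muw.
  have euw := emu _ _ muw.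
  pose D' : dist T := fun x => D x - 2 * (x == u) + (x == w).
  have hbal x : D' x + inflow mu' x + 2 * (x == u) = D x + inflow mu x.
    rewrite (inflow_pushed _ hmu) /D'.
    by case: eqVneq => [->|_] /=; lia.
  have [Q [DQ kQ]] : kreachable e D' v k.
    apply: (IH _ mu'); first by move: ltn; rewrite (fsize_pushed hmu); lia.
    split; first split; first exact: pushed_edge hmu emu.
    - move=> x; have := bmu x; have := hbal x.
      by rewrite (outflow_pushed _ hmu); lia.
    - have := hk; have := hbal v.
      by rewrite (outflow_pushed _ hmu); lia.
  exists Q; split=> //; apply: rt_trans DQ; apply: rt_step.
  by exists u, w.
(* If no move is executable, every vertex with outflow holds at most one pebble, so outflow is at
   most inflow everywhere. The totals agree, hence equality holds at each vertex and [v] already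
   holds [k] pebbles. *)
exists D; split; first exact: rt_refl.
have le_oi x : outflow mu x <= inflow mu x.
  move/existsPn: hno => /(_ x); have := bmu x; lia.
have eq_oi : outflow mu v = inflow mu v.
  apply/eqP; move: (fsize_inflow mu); rewrite /fsize => /eqP.
  rewrite (leqif_sum (fun x _ => leqif_eq (le_oi x))).
  by move/forallP/(_ v).
by move: hk; rewrite eq_oi; lia.
Qed.

Lemma kreachable_flow D v k : kreachable e D v k -> exists mu, flow_to D v k mu.
Proof.
case=> Q [/preach_flow[mu emu hmu] kQ]; exists mu.
by split; [split=> // x; have := hmu x; lia | have := hmu v; lia].
Qed.

Lemma flow_to_le D v k mu : flow_to D v k mu -> k + inflow mu v <= dsize D.
Proof.
case=> [[_ bmu]] hk.
have : \sum_x (outflow mu x + outflow mu x + k * ((x == v) && true))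
       <= \sum_x (D x + inflow mu x).
  apply: leq_sum => x _; case: eqVneq => [->|_] /=; first lia.
  by have := bmu x; lia.
rewrite !big_split /= sum_delta -fsize_inflow -/(fsize mu) -/(dsize D).
have : inflow mu v <= fsize mu by rewrite fsize_inflow (bigD1 v) //= leq_addr.
lia.
Qed.

Lemma kreachableP D v k : reflect (kreachable e D v k) (kreachableb e D v k).
Proof. by rewrite /kreachableb; case: excluded_middle_informative => h; constructor. Qed.

Lemma reachP D v k : (exists mu, flow_to D v k mu) <-> k <= reach e D v.
Proof.
split=> [[mu hmu]|lek].
  have kD : k < (dsize D).+1 by have := flow_to_le hmu; lia.
  apply: (@leq_bigmax_cond _ _ (fun i : 'I_(dsize D).+1 => nat_of_ord i) (Ordinal kD)).
  by apply/kreachableP; apply: flow_kreachable hmu.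
have : kreachable e D v (reach e D v).
  rewrite /reach; apply: (big_ind (fun n => kreachable e D v n)).
  - by exists D; split=> //; apply: rt_refl.
  - by move=> m n hm hn; rewrite /maxn; case: ifP.
  - by move=> i /kreachableP.
case=> Q [DQ leQ]; apply: kreachable_flow.
by exists Q; split=> //; apply: leq_trans leQ.
Qed.

Lemma exc_reach D v : exc e D v = (reach e D v).-1.
Proof.
rewrite /exc; case: kreachableP => [_|h]; first by rewrite subn1.
case E: (reach e D v) => [//|k]; case: h.
have /reachP[mu] : 1 <= reach e D v by rewrite E.
exact: flow_kreachable.
Qed.

Lemma covE D : cov e D = \sum_v (0 < reach e D v).
Proof.
rewrite /cov -sum1_card big_mkcond /=; apply: eq_bigr => v _.
rewrite inE; suff -> : kreachableb e D v 1 = (0 < reach e D v) by case: ltnP.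
apply/kreachableP/idP => [/kreachable_flow/reachP //|/reachP[mu]].
exact: flow_kreachable.
Qed.

Lemma reach_le_dsize D v : reach e D v <= dsize D.
Proof. by have /reachP[mu /flow_to_le] := leqnn (reach e D v); lia. Qed.

Lemma reach_ge D v : D v <= reach e D v.
Proof.
apply/reachP; exists flow0; split; first exact: flow_flow0.
by rewrite inflow0 outflow0; lia.
Qed.

Lemma reach_adj D u v k : e u v -> 2 * k <= reach e D u -> k <= reach e D v.
Proof.
move=> euv /reachP[mu [[emu bmu] hk]]; apply/reachP.
have [mu' h] := pushed_ex k u v mu.
exists mu'; split; first split; first exact: edge_pushed h euv emu.
  move=> x; rewrite (inflow_pushed _ h) (outflow_pushed _ h).
  by have := bmu x; case: (eqVneq x u) => [->|_] /=; lia.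
rewrite (inflow_pushed _ h) (outflow_pushed _ h) eqxx.
by have := bmu v; case: (eqVneq v u) => [->|_] /=; lia.
Qed.

(** If the balance at [w] breaks without the extra pebble, undoing a move from [w] to [w'] repairs
    it and shifts the deficit to [w']. Each undoing shortens the flow, so the deficit finally
    vanishes or costs one pebble at [v]. *)
Lemma flow_drop_pebble D w v k mu :
  flow_to (fun x => D x + (x == w)) v k.+1 mu ->
  exists2 mu', flow_to D v k mu' & fsize mu' <= fsize mu.
Proof.
have [n] := ubnP (fsize mu); elim: n => // n IH in w mu *.
move=> ltn [[emu bmu] hk].
case: (leqP (2 * outflow mu w) (D w + inflow mu w)) => hw.
  exists mu => //; split; first split=> //.
    by move=> x; have := bmu x; case: eqVneq => [->|_] /=; lia.
  by move: hk; case: eqP => /=; lia.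
have /outflow_pos[w' muw] : 0 < outflow mu w by lia.
have [mu' h] := pulled_ex muw.
have [||mu'' h1 h2] := IH w' mu'.
- by move: ltn; rewrite (fsize_pushed h); lia.
- split; first split; first exact: pushed_edge h emu.
    move=> x; have := bmu x.
    by rewrite (inflow_pushed _ h) (outflow_pushed _ h); lia.
  by move: hk; rewrite (inflow_pushed _ h) (outflow_pushed _ h); lia.
exists mu'' => //; apply: leq_trans h2 _.
by rewrite (fsize_pushed h) leq_addr.
Qed.

(** * Flows with the fewest moves *)

Definition opt_flow_to D v k mu :=
  flow_to D v k mu /\ forall mu', flow_to D v k mu' -> fsize mu <= fsize mu'.

Lemma opt_flow_ex D v k : k <= reach e D v -> exists mu, opt_flow_to D v k mu.
Proof.
move/reachP => [mu]; have [n] := ubnP (fsize mu); elim: n => // n IH in mu *.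
move=> ltn hmu.
case: (excluded_middle_informative
         (exists2 mu', flow_to D v k mu' & fsize mu' < fsize mu)) => [[mu' h1 h2]|hn].
  by apply: (IH mu') => //; lia.
exists mu; split=> // mu' h; rewrite leqNgt; apply/negP => lt.
by apply: hn; exists mu'.
Qed.

Section Opt.
Variables (D : dist T) (v : T) (k : nat) (mu : T -> T -> nat).
Hypothesis opt : opt_flow_to D v k mu.

(** Undoing a move out of [v] gains two pebbles there and takes one from its target; by
    [flow_drop_pebble] that loss costs at most one of the two, so a shorter flow would remain. *)
Lemma opt_outflow : outflow mu v = 0.
Proof.
have [[[emu bmu] hk] hmin] := opt.
apply/eqP; rewrite -leqn0 leqNgt; apply/negP => /outflow_pos[w muw].
have [mu' h] := pulled_ex muw.
have [|mu'' [h1 h1'] h2] := @flow_drop_pebble D w v k.+1 mu'.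
  split; first split; first exact: pushed_edge h emu.
    move=> x; have := bmu x.
    by rewrite (inflow_pushed _ h) (outflow_pushed _ h); lia.
  by move: hk; rewrite (inflow_pushed _ h) (outflow_pushed _ h) eqxx; lia.
have := hmin mu''; rewrite (fsize_pushed h).
have h3 : flow_to D v k mu'' by split=> //; lia.
by move=> /(_ h3); lia.
Qed.

Lemma opt_inflow : D v < k -> D v + inflow mu v = k.
Proof.
have [[[emu bmu] hk] hmin] := opt; have ho := opt_outflow.
move=> ltDk; apply/eqP; rewrite eqn_leq; apply/andP; split; last lia.
rewrite leqNgt; apply/negP => lt.
have /inflow_pos[y muy] : 0 < inflow mu v by lia.
have [mu' h] := pulled_ex muy.
have : flow_to D v k mu'.
  have ho' : outflow mu' v = 0 by have := ho; rewrite (outflow_pushed _ h); lia.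
  split; first split; first exact: pushed_edge h emu.
    move=> x; have := bmu x; rewrite (inflow_pushed _ h) (outflow_pushed _ h).
    by case: (eqVneq x v) => [->|_] /=; lia.
  by move: lt; rewrite (inflow_pushed _ h) eqxx; lia.
by move/hmin; rewrite (fsize_pushed h); lia.
Qed.

Hypothesis irr_e : irreflexive e.

Lemma opt_contrib y a : a <= mu y v -> 0 < mu y v ->
  exists2 mu', flow_to D y (2 * a) mu' & fsize mu' + a = fsize mu.
Proof.
have [[[emu bmu] hk] hmin] := opt; have ho := opt_outflow.
move=> lea /emu eyv.
have yv : (v == y) = false by apply/eqP => E; rewrite E irr_e in eyv.
have [mu' h] := pulled_ex lea.
have ho' : outflow mu' v = 0 by have := ho; rewrite (outflow_pushed _ h); lia.
exists mu'; last by rewrite (fsize_pushed h).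
split; first split; first exact: pushed_edge h emu.
  move=> x; have := bmu x; rewrite (inflow_pushed _ h) (outflow_pushed _ h).
  by case: (eqVneq x v) => [->|_] /=; lia.
have := bmu y; rewrite (inflow_pushed _ h) (outflow_pushed _ h) eqxx.
by rewrite eq_sym yv; lia.
Qed.

(* One of the moves from [y] into [v] is withheld and the [k - 1] remaining pebbles
   of [v] are sent to [y]. *)
Lemma opt_swap y : symmetric e -> 0 < k -> 0 < mu y v ->
  exists2 mu', flow_to D y (2 + k.-1./2) mu' & (fsize mu').+1 = fsize mu + k.-1./2.
Proof.
have [[[emu bmu] hk] hmin] := opt; have ho := opt_outflow.
move=> sym_e k0 muy; have eyv := emu _ _ muy.
have yv : (v == y) = false by apply/eqP => E; rewrite E irr_e in eyv.
have [mu1 h] := pulled_ex muy.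
have [mu2 h2] := pushed_ex k.-1./2 v y mu1.
have ho' : outflow mu1 v = 0 by have := ho; rewrite (outflow_pushed _ h); lia.
exists mu2; last by rewrite (fsize_pushed h2) (fsize_pushed h); lia.
split; first split.
- by apply: edge_pushed h2 _ (pushed_edge h emu); rewrite sym_e.
- move=> x; have := bmu x.
  rewrite (inflow_pushed _ h2) (outflow_pushed _ h2).
  rewrite (inflow_pushed _ h) (outflow_pushed _ h).
  case: (eqVneq x v) => [->|_] /=; last lia.
  by rewrite yv; move: hk; rewrite (inflow_pushed _ h) eqxx; lia.
- have := bmu y; rewrite (inflow_pushed _ h2) (outflow_pushed _ h2).
  rewrite (inflow_pushed _ h) (outflow_pushed _ h).
  by rewrite eqxx eq_sym yv; lia.
Qed.

End Opt.

(** Flows for the summands are added pointwise; the balance conditions are linear. *)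
Lemma flow_to_sum (I : finType) (D : I -> dist T) v (k : I -> nat) :
  (forall i, k i <= reach e (D i) v) ->
  \sum_i k i <= reach e (fun x => \sum_i D i x) v.
Proof.
move=> hk.
have /fin_all_exists[mu hmu] i : exists mu, flow_to (D i) v (k i) mu by apply/reachP.
pose m := fun x y => \sum_i mu i x y.
have inE x : inflow m x = \sum_i inflow (mu i) x by rewrite /inflow /m exchange_big.
have outE x : outflow m x = \sum_i outflow (mu i) x by rewrite /outflow /m exchange_big.
apply/reachP; exists m; split; first split.
- move=> x y; rewrite lt0n sum_nat_eq0 negb_forall => /existsP[i] /=.
  by rewrite -lt0n; case: (hmu i) => [[h _] _] /h.
- move=> x; rewrite inE outE big_distrr /= -big_split /=.
  by apply: leq_sum => i _; case: (hmu i) => [[_ h] _].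
- rewrite inE outE big_distrr /= -!big_split /=.
  by apply: leq_sum => i _; case: (hmu i).
Qed.

End Flow.

(** * Levels and demands *)

Section Discharge.
Variables (T : finType) (e : rel T) (P : dist T).
Hypotheses (sym_e : symmetric e) (irr_e : irreflexive e).
Implicit Types (u v w x y : T) (i j : nat).

(** * Reach under single units, levels and contributors *)

Definition ureach w v := reach e (restr P [:: w]) v.
Definition nunits v := \sum_w (0 < ureach w v).
Definition uexc v := \sum_w (ureach w v).-1.

Lemma restr1E w v : restr P [:: w] v = P w * (v == w).
Proof. by rewrite /restr inE; case: eqVneq => [->|_]; rewrite ?muln1 ?muln0. Qed.

Lemma dsize_restr1 w : dsize (restr P [:: w]) = P w.
Proof.
rewrite /dsize (bigD1 w) //= restr1E eqxx muln1 big1 ?addn0 // => v /negPf h.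
by rewrite restr1E h muln0.
Qed.

Lemma ureach_le w v : ureach w v <= P w.
Proof. by rewrite -[leqRHS]dsize_restr1 reach_le_dsize. Qed.

Lemma ureach_self v : ureach v v = P v.
Proof.
apply/eqP; rewrite eqn_leq ureach_le /=.
by have := reach_ge e (restr P [:: v]) v; rewrite restr1E eqxx muln1.
Qed.

(** All pebbles on [v] arrive by moves, and each move destroys one pebble. *)
Lemma ureach_far w v : v != w -> 2 * ureach w v <= P w.
Proof.
move=> /negPf vw; have /reachP[mu h] := leqnn (ureach w v).
have := flow_to_le h; case: h => _; rewrite dsize_restr1 restr1E vw; lia.
Qed.

Lemma sum_restr1 : P = fun x => \sum_w restr P [:: w] x.
Proof.
apply: functional_extensionality => v.
rewrite (bigD1 v) //= restr1E eqxx muln1 big1 ?addn0 // => w h.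
by rewrite restr1E eq_sym (negPf h) muln0.
Qed.

Lemma sum_ureach_le v : \sum_w ureach w v <= reach e P v.
Proof.
have := flow_to_sum (fun w => leqnn (ureach w v)).
by rewrite -sum_restr1.
Qed.

Lemma uexcE v : uexc v + nunits v = \sum_w ureach w v.
Proof.
by rewrite -big_split; apply: eq_bigr => w _ /=; case: (ureach w v) => // n; lia.
Qed.

(* [v] gets [2 ^ i] pebbles under [P] but under none of the units. *)
Definition level v i := [forall w, ureach w v < 2 ^ i] && (2 ^ i <= reach e P v).

Lemma levelP v i :
  reflect ((forall w, ureach w v < 2 ^ i) /\ 2 ^ i <= reach e P v) (level v i).
Proof. by apply: (iffP andP) => -[/forallP]. Qed.

(** One cheapest flow is chosen for each pair, so that contributors and costs are functions of [v]
    and [i]; the choice is meaningful only when [2 ^ i] pebbles can reach [v]. *)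
Definition opt v i : T -> T -> nat :=
  epsilon (inhabits (@flow0 T)) (opt_flow_to e P v (2 ^ i)).

Definition cost v i := fsize (opt v i).
Definition contributors v i := [set y | 0 < opt v i y v].

Section Opt.
Variables (v : T) (i : nat).
Hypothesis vi : level v i.

Lemma optP : opt_flow_to e P v (2 ^ i) (opt v i).
Proof. by case/levelP: vi => _ h; apply: epsilon_spec; apply: opt_flow_ex. Qed.

Lemma level_pebbles : P v < 2 ^ i.
Proof. by case/levelP: vi => /(_ v); rewrite ureach_self. Qed.

Lemma opt_sum : P v + \sum_(y in contributors v i) opt v i y v = 2 ^ i.
Proof.
rewrite -(opt_inflow optP level_pebbles); congr (_ + _).
rewrite /inflow [RHS](bigID (mem (contributors v i))) /= [X in _ = _ + X]big1 ?addn0 //.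
by move=> y; rewrite inE; case: (opt v i y v).
Qed.

Lemma contributors_gt0 : 0 < #|contributors v i|.
Proof.
rewrite card_gt0; apply/negP => /eqP h; have := opt_sum.
by rewrite h big_set0; have := level_pebbles; lia.
Qed.

Lemma card_contributors_le : P v + #|contributors v i| <= 2 ^ i.
Proof.
rewrite -opt_sum leq_add2l -sum1_card; apply: leq_sum => y.
by rewrite inE.
Qed.

Lemma contributors_edge y : y \in contributors v i -> e y v.
Proof. by rewrite inE; case: optP => [[[h _] _] _] /h. Qed.

Lemma contributor_reach y : 2 * opt v i y v <= reach e P y.
Proof.
case: (posnP (opt v i y v)) => [->//|h].
have [mu hmu _] := opt_contrib optP irr_e (leqnn _) h.
by apply/reachP; exists mu.
Qed.

(** Withholding [a] moves from [y] to [v] leaves [2 * a] pebbles on [y]. *)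
Lemma contributor_cost y a j : 0 < a -> a <= opt v i y v -> 2 ^ j <= 2 * a ->
  cost y j + a <= cost v i.
Proof.
move=> a0 lea leja.
have [|mu [hmu1 hmu2] hs] := opt_contrib optP irr_e lea; first lia.
have hmu : flow_to e P y (2 ^ j) mu by split=> //; lia.
have /opt_flow_ex hex : 2 ^ j <= reach e P y by apply/reachP; exists mu.
have [_ /(_ _ hmu)] := epsilon_spec (inhabits (@flow0 T)) _ hex.
by rewrite -/(opt y j) /cost -hs leq_add2r.
Qed.

End Opt.

Lemma contributor_swap v i y : level v i.+1 -> y \in contributors v i.+1 ->
  2 ^ i < reach e P y /\ cost y i < cost v i.+1 + 2 ^ i.
Proof.
move=> vi; rewrite inE => hy.
have k0 : 0 < 2 ^ i.+1 by rewrite expn_gt0.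
have [mu hmu hs] := opt_swap (optP vi) irr_e sym_e k0 hy.
(* The withheld move leaves two pebbles on [y], and the other [2 ^ i.+1 - 1] pebbles of [v] send it
   [2 ^ i - 1] more. *)
have E : 2 + (2 ^ i.+1).-1./2 = (2 ^ i).+1.
  by rewrite expnS; have := expn_gt0 2 i; lia.
rewrite E in hmu.
have h1 : 2 ^ i < reach e P y by apply/reachP; exists mu.
split=> //; case: hmu => h2 h3.
have hmu' : flow_to e P y (2 ^ i) mu by split=> //; lia.
have /opt_flow_ex hex := ltnW h1.
have [_ /(_ _ hmu')] := epsilon_spec (inhabits (@flow0 T)) _ hex.
by rewrite -/(opt y i) /cost; move: hs E; rewrite /cost; lia.
Qed.

(* A vertex [u] with [single u i] receives all its [2 ^ i] pebbles from one neighbour,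
   which then lies on level [i + 1]; [u] demands one unit of charge from it. *)
Definition single v i := [&& level v i, P v == 0 & #|contributors v i| == 1].
Definition children v i := [set u | single u i && (v \in contributors u i)].

Lemma contributors1 v i y : #|contributors v i| == 1 -> level v i ->
  y \in contributors v i -> P v + opt v i y v = 2 ^ i.
Proof.
move=> /cards1P[z hz] vi; rewrite -(opt_sum vi) hz => /set1P ->.
by rewrite big_set1.
Qed.

(** A unit bringing [2 ^ i.+1] pebbles to [v] would bring [2 ^ i] to its neighbour [u]. *)
Lemma level_adj u v i : e u v -> level u i -> 2 ^ i.+1 <= reach e P v -> level v i.+1.
Proof.
move=> euv /levelP[h _] hv; apply/levelP; split=> // w; have := h w.
rewrite !ltnNge; apply: contra => hw; apply: (@reach_adj _ _ _ v).
  by rewrite sym_e.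
by rewrite -expnS.
Qed.

Lemma child_level v i u : u \in children v i ->
  level v i.+1 /\ cost v i.+1 + 2 ^ i <= cost u i.
Proof.
rewrite inE => /andP[/and3P[ui /eqP Pu cu] hv].
have := contributors1 cu ui hv; rewrite Pu add0n => ho.
split.
  apply: (level_adj _ ui); first by rewrite sym_e; apply: (contributors_edge ui hv).
  by rewrite expnS -ho; exact: contributor_reach.
by apply: contributor_cost; rewrite ?expn_gt0 ?ho // expnS.
Qed.

(* If a contributor [u] of [v] were also a child of [v], then exchanging one move
   [u -> v] would give a cheaper flow to [u]. *)
Lemma children_contributors v i : [disjoint children v i & contributors v i.+1].
Proof.
apply/pred0P => u; apply/negP => /andP[/= /child_level[vi h] hu].
by have [_] := contributor_swap vi hu; lia.
Qed.

Definition lev x := trunc_log 2 (P x).+1.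
(* Here [P x = 2 ^ j - 1] with [j = lev x], and the optimal flow to [(x, j)] brings one
   pebble to [x]; such an [x] also demands one unit of charge from the neighbour
   sending it. *)
Definition almost x := [&& 0 < P x, (P x).+1 == 2 ^ lev x, nunits x == 1,
  level x (lev x), #|contributors x (lev x)| == 1 &
  (lev x == 1) || (reach e P x == 2 ^ lev x)].
Definition clients v := [set x | almost x && (v \in contributors x (lev x))].

Lemma nunits_pos v w : 0 < ureach w v -> 0 < nunits v.
Proof. by move=> h; rewrite /nunits (bigD1 w) //= h. Qed.

Lemma nunits_gt1 v w w' : w != w' -> 0 < ureach w v -> 0 < ureach w' v -> 1 < nunits v.
Proof.
move=> h h1 h2; rewrite /nunits (bigD1 w) //= (bigD1 w') /= 1?eq_sym // h1 h2.
by lia.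
Qed.

Lemma nunits0 v w : nunits v = 0 -> ureach w v = 0.
Proof. by case: (posnP (ureach w v)) => // /nunits_pos; lia. Qed.

Lemma nunits1 v w w' : nunits v <= 1 -> w' != w -> 0 < ureach w v -> ureach w' v = 0.
Proof.
by move=> h hw h1; case: (posnP (ureach w' v)) => // /(nunits_gt1 hw)/(_ h1); lia.
Qed.

(** * Demands of almost full vertices *)

Section Client.
Variables (v x : T).
Hypothesis xv : x \in clients v.

Lemma client_almost : almost x.
Proof. by move: xv; rewrite inE => /andP[]. Qed.

Lemma client_pebbles : 0 < P x.
Proof. by case/andP: client_almost. Qed.

Lemma client_lev : exists j, lev x = j.+1 /\ (P x).+1 = 2 ^ j.+1.
Proof.
case/andP: client_almost => P0 /and5P[/eqP h _ _ _ _]; case E: (lev x) => [|j].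
  by rewrite E in h; lia.
by exists j; rewrite -E.
Qed.

Lemma client_edge : e v x.
Proof.
move: xv; rewrite inE => /andP[/andP[_ /and5P[_ _ h _ _]]].
exact: contributors_edge.
Qed.

Lemma client_opt : opt x (lev x) v x = 1.
Proof.
move: xv; rewrite inE => /andP[/andP[_ /and5P[/eqP h hn hl hc _]] hv].
by have := contributors1 hc hl hv; rewrite -h; lia.
Qed.

Lemma client_reach : 2 ^ (lev x).-1 < reach e P v.
Proof.
have [j [hj _]] := client_lev; move: xv; rewrite inE => /andP[/andP[_ /and5P[_ _ h _ _]]].
by rewrite hj in h * => /(contributor_swap h) [].
Qed.

(** Two pebbles on [v] from another unit would let that unit reach [x], which only the unit of [x]
    itself does. *)
Lemma client_other w : w != x -> ureach w v <= 1.
Proof.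
move=> wx; case/andP: client_almost => _ /and5P[_ /eqP h _ _ _].
rewrite leqNgt; apply/negP => hw.
have : 1 <= ureach w x by apply: (@reach_adj _ _ _ v) => //; exact: client_edge.
by rewrite (@nunits1 x x w) ?h // ureach_self client_pebbles.
Qed.

Lemma client_neq : v != x.
Proof. by apply/eqP => E; have := client_edge; rewrite E irr_e. Qed.

Lemma client_ureach : ureach x v = (2 ^ (lev x).-1).-1.
Proof.
have [j [hj hP]] := client_lev; rewrite hj /=.
have := ureach_far client_neq; rewrite expnS in hP => h1.
have h2 : (2 ^ j).-1 <= ureach x v.
  apply: (@reach_adj _ _ _ x); first by rewrite sym_e; exact: client_edge.
  by rewrite -/(ureach x x) ureach_self; lia.
by lia.
Qed.

(** If [x] and [v] contributed to each other on level 1, each would be strictly cheaper than the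
    other. *)
Lemma client1_level : lev x = 1 -> level v 1 /\ x \notin contributors v 1.
Proof.
move=> h; have hv : level v 1.
  apply/levelP; split; last by have := client_reach; rewrite h expn0 expn1.
  move=> w; case: (eqVneq w x) => [->|/client_other]; last by rewrite expn1 ltnS.
  by rewrite client_ureach h.
split=> //; apply/negP; rewrite inE => hx.
have h1 := @contributor_cost _ _ hv x 1 1 (leqnn _) hx (leqnn _).
have hl : level x 1 by case/andP: client_almost => _ /and5P[_ _]; rewrite h.
have := client_opt; rewrite h => ho.
have := @contributor_cost _ _ hl v 1 1 (leqnn _); rewrite ho => /(_ (leqnn _) (leqnn _)).
by lia.
Qed.

Hypothesis big : lev x != 1.

Lemma client2_lev : exists j, lev x = j.+2 /\ (P x).+1 = 2 ^ j.+2.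
Proof. by have [[|j] [hj hP]] := client_lev; [have := big; rewrite hj | exists j]. Qed.

Lemma client2_level : level v (lev x).-1.
Proof.
have [j [hj hP]] := client2_lev; apply/levelP; split; last exact/ltnW/client_reach.
rewrite hj /= => w; case: (eqVneq w x) => [->|/client_other h].
  by rewrite client_ureach hj /=; have := expn_gt0 2 (j.+1); lia.
by rewrite expnS; have := expn_gt0 2 j; lia.
Qed.

Lemma client2_ureach_gt0 : 0 < ureach x v.
Proof.
have [j [hj _]] := client2_lev; rewrite client_ureach hj /= expnS.
by have := expn_gt0 2 j; lia.
Qed.

Lemma client2_uexc : (uexc v).+2 = 2 ^ (lev x).-1.
Proof.
rewrite /uexc (bigD1 x) //= big1 => [|w /client_other]; last lia.
have := client2_ureach_gt0; rewrite client_ureach; lia.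
Qed.

(** As [v] holds at most one pebble, a sole contributor [x] would make at least [2 ^ i - 1] moves
    into [v], which needs more than the [2 ^ lev x] pebbles that can reach [x]. *)
Lemma client2_contributor i : level v i -> lev x <= i ->
  exists2 y, y \in contributors v i & y != x.
Proof.
move=> vi lei; have [j [hj _]] := client2_lev.
case: (boolP [exists y in contributors v i, y != x]) => [/existsP[y /andP[]]|hn].
  by exists y.
have hx : contributors v i = [set x].
  have /card_gt0P[y hy] := contributors_gt0 vi.
  have all_x z : z \in contributors v i -> z = x.
    by move=> hz; apply/eqP; move: hn => /existsPn/(_ z); rewrite hz negbK.
  apply/setP => z; rewrite in_set1; apply/idP/eqP => [/all_x //|->].
  by rewrite -(all_x y hy).
have := opt_sum vi; rewrite hx big_set1 => hs.
have := contributor_reach vi x.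
case/andP: client_almost => _ /and5P[_ _ _ _]; rewrite (negPf big) /= => /eqP ->.
have : P v <= 1 by rewrite -ureach_self; apply: client_other; exact: client_neq.
have : 2 ^ lev x <= 2 ^ i by rewrite leq_exp2l.
rewrite hj !expnS; have := expn_gt0 2 j; lia.
Qed.

End Client.

Lemma children_clients v i : [disjoint children v i & clients v].
Proof.
apply/pred0P => u; apply/negP => /andP[/= hu /client_pebbles].
by move: hu; rewrite inE => /andP[/and3P[_ /eqP ->]].
Qed.

Lemma children_edge v i u : u \in children v i -> e v u.
Proof. by rewrite inE => /andP[/and3P[h _ _]] /(contributors_edge h). Qed.

Lemma card_neighbours v i : level v i.+1 ->
  #|children v i| + #|contributors v i.+1 :|: clients v| <= maxdeg e.
Proof.
move=> vi; apply: leq_trans (leq_bigmax v); rewrite /degree.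
have <- : #|children v i :|: (contributors v i.+1 :|: clients v)| =
          #|children v i| + #|contributors v i.+1 :|: clients v|.
  rewrite cardsU setIUr (disjoint_setI0 (children_contributors v i)).
  by rewrite (disjoint_setI0 (children_clients v i)) setU0 cards0 subn0.
apply: subset_leq_card; apply/subsetP => y; rewrite !in_setU [in X in _ -> X]inE => /or3P[].
- exact: children_edge.
- by rewrite sym_e; apply: contributors_edge.
- exact: client_edge.
Qed.

End Discharge.

(** * Balance at a vertex *)

Lemma leq_expn2 n : n.+1 <= 2 ^ n.
Proof. exact: ltn_expl. Qed.

Section Balance.
Variables (T : finType) (e : rel T) (P : dist T).
Hypotheses (sym_e : symmetric e) (irr_e : irreflexive e).
Implicit Types (u v w x y : T).

Notation B := (dsize P).
(** The index is shifted: [i] stands for level [i.+1], where [v] serves single vertices on level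
    [i]. Level 0 serves no child. *)
Definition levels v := [set i : 'I_B | level e P v i.+1].

(* [load] is the charge that [v] gives away, [demand] the charge that it receives. *)
Definition load v :=
  \sum_(i in levels v) #|children e P v i| + #|clients e P v|.
Definition demand v :=
  single e P v 0 + \sum_(i in levels v) single e P v i.+1 + almost e P v.

Lemma level_bound v i : level e P v i -> i < B.
Proof.
case/levelP => _ h; apply: leq_trans (leq_expn2 i) _.
exact: leq_trans h (reach_le_dsize _ _ _).
Qed.

(** Double counting: a demanding vertex has exactly one contributor at the level concerned, and that
    vertex is the one charged. *)
Lemma sum_load : \sum_v load v = \sum_v demand v.
Proof.
rewrite /load /demand !big_split /=; congr (_ + _).
  have E v : single e P v 0 + \sum_(i in levels v) single e P v i.+1
           = \sum_(i < B.+1) single e P v i.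
    rewrite big_ord_recl; congr (_ + _); rewrite big_mkcond /=.
    apply: eq_bigr => i _; rewrite inE /bump /= add1n.
    by case: ifP => // h; rewrite /single h.
  rewrite -big_split (eq_bigr _ (fun v _ => E v)) /=.
  have F v : \sum_(i in levels v) #|children e P v i| = \sum_(i < B.+1) #|children e P v i|.
    rewrite big_ord_recr /= [X in _ = _ + X]eq_card0 => [|u].
      rewrite addn0 big_mkcond /=; apply: eq_bigr => i _; rewrite inE.
      case: ifP => // /negP h; apply/esym/eq_card0 => u; apply/negP => hu; apply: h.
      by case: (child_level sym_e irr_e hu).
    apply/negP => /(child_level sym_e irr_e)[/level_bound]; lia.
  rewrite (eq_bigr _ (fun v _ => F v)) exchange_big [RHS]exchange_big /=.
  apply: eq_bigr => i _.
  under eq_bigr => v _ do rewrite -sum1_card big_mkcond.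
  rewrite exchange_big /=; apply: eq_bigr => u _.
  under eq_bigr => v _ do rewrite inE.
  case: (boolP (single e P u i)) => [/and3P[_ _ /eqP h]|_]; last by rewrite big1.
  by rewrite -big_mkcond /= sum1_card h.
under eq_bigr => v _ do rewrite -sum1_card big_mkcond.
rewrite exchange_big /=; apply: eq_bigr => u _.
under eq_bigr => v _ do rewrite inE.
case: (boolP (almost e P u)) => [/andP[_ /and5P[_ _ _ /eqP h _]]|_]; last by rewrite big1.
by rewrite -big_mkcond /= sum1_card h.
Qed.

(** Here [i] is the lowest index; [n.+1] distinct indices from [i] on include one that is at least
    [i + n]. *)
Lemma levels_pow v : levels v != set0 -> exists2 i, i \in levels v &
  forall n, n.+1 = #|levels v| -> 2 ^ (i.+1 + n) <= reach e P v.
Proof.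
case/set0Pn => j hj; case: (arg_minnP (fun i : 'I_B => i : nat) hj) => i hi mini.
exists i => // n hn; rewrite leqNgt; apply/negP => lt.
have : #|levels v| <= n; last lia.
rewrite -[leqRHS](size_iota i) cardE -(size_map val).
apply: uniq_leq_size; first by rewrite map_inj_uniq ?enum_uniq //; exact: val_inj.
move=> _ /mapP[k + ->]; rewrite mem_enum mem_iota => hk; rewrite mini //=.
move: hk; rewrite inE => /levelP[_ h]; have := leq_ltn_trans h lt.
by rewrite ltn_exp2l.
Qed.

Variable d : nat.
Hypotheses (d_gt0 : 0 < d) (max_e : maxdeg e = d.+2).

Lemma children_bound v i : level e P v i.+1 ->
  #|children e P v i| + #|contributors e P v i.+1 :|: clients e P v| <= d.+2.
Proof. by rewrite -max_e; apply: card_neighbours. Qed.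

Definition small_clients v := [forall x in clients e P v, lev P x == 1].

(** At each level children and contributors are distinct neighbours. All clients are charged to
    level 1, where [client1_level] keeps them apart from the contributors too. *)
Lemma load_small v : small_clients v ->
  load v + \sum_(i in levels v) #|contributors e P v i.+1| <= #|levels v| * d.+2.
Proof.
move=> /forallP small; rewrite /load addnAC -big_split /= -sum_nat_const.
have bnd i : i \in levels v ->
    #|children e P v i| + #|contributors e P v i.+1| <= d.+2.
  rewrite inE => /children_bound; apply: leq_trans; rewrite leq_add2l.
  by apply/subset_leq_card/subsetUl.
have [->|/set0Pn[x hx]] := eqVneq (clients e P v) set0.
  by rewrite cards0 addn0; apply: leq_sum.
have levx := eqP (implyP (small x) hx).
have [v1 _] := client1_level sym_e irr_e hx levx.
have i0 : 0 < B by have := level_bound v1; lia.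
have h0 : Ordinal i0 \in levels v by rewrite inE.
rewrite (bigD1 (Ordinal i0)) //= [leqRHS](bigD1 (Ordinal i0)) //= addnAC.
apply: leq_add; last by apply: leq_sum => i /andP[/bnd].
have := children_bound v1; rewrite cardsU disjoint_setI0 ?cards0 ?subn0 ?addnA //.
apply/pred0P => y /=; apply/negP => /andP[h1 h2].
have levy := eqP (implyP (small y) h2).
by have [_] := client1_level sym_e irr_e h2 levy; rewrite h1.
Qed.

Lemma uexc_le v : 0 < reach e P v -> uexc e P v < reach e P v.
Proof.
move=> h; case: (posnP (nunits e P v)) => [n0|npos].
  by rewrite /uexc big1 // => w _; rewrite (nunits0 w n0).
by have := uexcE e P v; have := sum_ureach_le e P v; lia.
Qed.

(* The charge of [v] is [d * (exc P - uexc) + nunits - 1]; it stays nonnegative after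
   the transfers. *)
Definition balanced v :=
  load v + 1 + d * uexc e P v <= d * (reach e P v).-1 + nunits e P v + demand v.

(** One unit of excess pays the [d] demands of one level; [b] further units of excess must pay the
    surplus load [a]. *)
Lemma balanced_suff v a b : load v <= d * #|levels v| + a -> 
  0 < reach e P v ->
  #|levels v| + b + uexc e P v < reach e P v ->
  a + 1 <= d * b + nunits e P v + demand v -> balanced v.
Proof.
move=> h1 h2 h3 h4; rewrite /balanced.
have : d * (#|levels v| + b + uexc e P v) <= d * (reach e P v).-1.
  by rewrite leq_mul2l; apply/orP; right; lia.
by rewrite !mulnDr; lia.
Qed.

(* The contributors of an empty vertex are either two, or a single one, which is
   compensated by a demand. *)
Lemma load_small_empty v : small_clients v -> P v = 0 ->
  load v <= d * #|levels v| + \sum_(i in levels v) single e P v i.+1.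
Proof.
move=> small Pv; have := load_small small.
have : #|levels v| * 2 <= \sum_(i in levels v)
         (#|contributors e P v i.+1| + single e P v i.+1).
  rewrite -sum_nat_const; apply: leq_sum => i; rewrite inE => vi.
  have := contributors_gt0 vi; rewrite /single vi Pv eqxx /=; case: eqP => /=; lia.
rewrite big_split /=; nia.
Qed.

Lemma load_small_any v : small_clients v -> load v <= d * #|levels v| + #|levels v|.
Proof.
move=> small; have := load_small small.
have : #|levels v| * 1 <= \sum_(i in levels v) #|contributors e P v i.+1|.
  rewrite -sum_nat_const; apply: leq_sum => i; rewrite inE => vi.
  exact: contributors_gt0 vi.
nia.
Qed.

Lemma sum_ureach_level v i : level e P v i ->
  uexc e P v + nunits e P v <= nunits e P v * (2 ^ i).-1.
Proof.
move=> /levelP[h _]; rewrite uexcE /nunits big_distrl /=; apply: leq_sum => w _.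
by have := h w; case: (ureach e P w v) => // k; lia.
Qed.

(** Turns the exponential bound into polynomial inequalities fit for [nia]. *)
Lemma pow_lower i n m : 2 ^ (i.+1 + n) <= m ->
  exists M N, [/\ 2 ^ i.+1 = M, 1 < M, n < N & M * N <= m].
Proof.
move=> h; exists (2 ^ i.+1), (2 ^ n); split=> //; last by rewrite -expnD.
- by rewrite expnS; have := leq_expn2 i; lia.
- exact: leq_expn2.
Qed.

Lemma balanced_small0 v : 0 < reach e P v -> small_clients v ->
  nunits e P v = 0 -> balanced v.
Proof.
move=> f0 small r0.
have Pv : P v = 0 by rewrite -(ureach_self e P) (nunits0 v r0).
have v0 : level e P v 0 by apply/levelP; split=> // w; rewrite (nunits0 w r0).
have s0 : single e P v 0.
  rewrite /single v0 Pv /=; have := card_contributors_le v0.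
  have := contributors_gt0 v0; rewrite expn0; lia.
apply: (balanced_suff (load_small_empty small Pv) (b := 0)) => //; last first.
  by rewrite /demand s0; lia.
have -> : uexc e P v = 0 by rewrite /uexc big1 // => w _; rewrite (nunits0 w r0).
rewrite !addn0; have [->|/levels_pow[i _ h]] := eqVneq (levels v) set0.
  by rewrite cards0.
case E: #|levels v| => [//|n].
have [M [N [_ M1 nN]]] := pow_lower (h n (esym E)); nia.
Qed.

Lemma level_uexc1 v : nunits e P v = 1 ->
  levels v != set0 -> exists i n, 
  [/\ i \in levels v, #|levels v| = n.+1, (uexc e P v).+1 < 2 ^ i.+1 &
   2 ^ (i.+1 + n) <= reach e P v].
Proof.
move=> r1 /levels_pow[i hi h].
have : 0 < #|levels v| by rewrite card_gt0; apply/set0Pn; exists i.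
case E: #|levels v| => [//|n] _; exists i, n; split=> //; last exact: h.
have := hi; rewrite inE => /sum_ureach_level; rewrite r1 mul1n.
by have := leq_expn2 i.+1; lia.
Qed.

Lemma balanced_small1 v : 0 < reach e P v -> small_clients v ->
  nunits e P v = 1 -> balanced v.
Proof.
move=> f0 small r1; have ltf := uexc_le f0.
have [Pv|Pv] := posnP (P v).
  apply: (balanced_suff (load_small_empty small Pv) (b := 0)) => //; last first.
    by rewrite /demand; lia.
  rewrite addn0; have [->|h] := eqVneq (levels v) set0; first by rewrite cards0.
  have [i [n [_ -> h1 /pow_lower[M [N [hM M1 nN hf]]]]]] := level_uexc1 r1 h.
  by rewrite hM in h1; nia.
have Puv : uexc e P v = (P v).-1.
  rewrite /uexc (bigD1 v) //= ureach_self big1 ?addn0 // => w wv.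
  by rewrite (@nunits1 _ _ _ v v) ?r1 // ureach_self.
have [L0|h] := eqVneq (levels v) set0.
  apply: (balanced_suff (load_small_any small) (b := 0)) => //.
    by rewrite L0 cards0; lia.
  by rewrite L0 cards0; lia.
have [i [n [hi En h1 hf0]]] := level_uexc1 r1 h.
have [M [N [hM M1 nN hf]]] := pow_lower hf0.
case: (leqP (2 * #|levels v| + uexc e P v) (reach e P v).-1) => hc.
  apply: (balanced_suff (load_small_any small) (b := #|levels v|)) => //; first lia.
  by have : #|levels v| <= d * #|levels v| by [rewrite leq_pmull]; lia.
(* With less than two units of excess per level, the bound [M * N] on the reach leaves only the
   extremal case of a vertex one pebble short of its lowest level. *)
have PM : (P v).+1 = M by rewrite hM in h1; nia.
have hd : load v <= d * n.+1 + n + demand v.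
  have := load_small small.
  (* The lowest level saves one extra unit: either it has two contributors, or [v] is almost full
     and makes a demand. *)
  have : #|levels v| * 1 + 1 <= \sum_(k in levels v) #|contributors e P v k.+1| + demand v.
    rewrite muln1 -sum1_card (bigD1 i) //= [in leqRHS](bigD1 i) //=.
    rewrite addnAC [leqRHS]addnAC; apply: leq_add; last first.
      by apply: leq_sum => k /andP[]; rewrite inE => vk _; exact: contributors_gt0 vk.
    have vi : level e P v i.+1 by move: hi; rewrite inE.
    have := contributors_gt0 vi.
    case: (ltnP 1 #|contributors e P v i.+1|) => [|K1 K0]; first lia.
    suff : almost e P v by rewrite /demand => ->; lia.
    have hl : lev P v = i.+1.
      by rewrite /lev PM -hM trunc_expnK.
    have Keq : #|contributors e P v i.+1| == 1 by lia.
    rewrite /almost hl Pv PM hM eqxx r1 eqxx vi Keq /=.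
    (* With a single level the reach is exactly [M]; with more levels [M = 2], so [lev P v = 1].
       These are the two alternatives in [almost]. *)
    case: (eqVneq n 0) => [n0|nn0].
      by apply/orP; right; rewrite En n0 in hc; rewrite n0 in hf0;
         rewrite -hM; rewrite addn0 in hf0; have := hM; lia.
    have M2 : M = 2 by move: hc; rewrite En Puv; nia.
    by move: hM; rewrite M2 expnS; have := leq_expn2 i; lia.
  by rewrite En; nia.
apply: (@balanced_suff v (n + demand v) n) => //.
- by rewrite En addnA.
- by rewrite En; rewrite hM in h1; nia.
- by rewrite r1; have : n <= d * n by [rewrite leq_pmull]; lia.
Qed.

Lemma balanced_small2 v : 0 < reach e P v -> small_clients v ->
  1 < nunits e P v -> balanced v.
Proof.
move=> f0 small r2; have ltf := uexc_le f0.
have hs : uexc e P v + nunits e P v <= reach e P v.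
  by rewrite uexcE; exact: sum_ureach_le.
have [c hc1 hc2] : exists2 c, #|levels v| + c + uexc e P v < reach e P v &
   #|levels v| < c + nunits e P v.
  have [->|/levels_pow[i hi h]] := eqVneq (levels v) set0.
    by exists 0; rewrite cards0 //; lia.
  case En: #|levels v| => [|n]; first by exists 0; lia.
  have [M [N [hM M1 nN hf]]] := pow_lower (h n (esym En)).
  have := hi; rewrite inE => /sum_ureach_level; rewrite hM => hr.
  (* All excess left after one unit per level. With at least [n.+2] units reaching [v] the bound
     [hs] suffices, with fewer the bound [hr]; the subtraction is never truncated. *)
  exists ((reach e P v).-1 - uexc e P v - n.+1); last first.
    move: ltf hr hs hf r2 nN M1; move: (uexc e P v) (nunits e P v) (reach e P v).
    move=> s r f; case: (leqP n.+1 r.-1) => hrn; nia.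
  move: ltf hr hs hf r2 nN M1; move: (uexc e P v) (nunits e P v) (reach e P v).
  move=> s r f; case: (leqP n.+1 r.-1) => hrn; nia.
apply: (balanced_suff (load_small_any small) (b := c)) => //.
have : c <= d * c by rewrite leq_pmull.
lia.
Qed.

(** * Balance at a vertex having a client with at least three pebbles *)

Section BigClient.
Variables (v x : T).
Hypotheses (xv : x \in clients e P v) (big : lev P x != 1).

Lemma big_index : exists2 i : 'I_B, i \in levels v & lev P x = i.+2.
Proof.
have [j [hj _]] := client2_lev xv big; have := client2_level sym_e irr_e xv big.
rewrite hj /= => vj; have jB : j < B by have := level_bound vj; lia.
by exists (Ordinal jB); rewrite ?inE.
Qed.

Lemma big_room : #|levels v| + 1 + uexc e P v < reach e P v.
Proof.
have := client2_uexc sym_e irr_e xv big; have := client_reach sym_e irr_e xv.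
have := client2_ureach_gt0 sym_e irr_e xv big; have := client_ureach sym_e irr_e xv.
have [j hj ->] := big_index => /=.
have /levels_pow[i hi h] : levels v != set0 by apply/set0Pn; exists j.
case En: #|levels v| => [|n]; first lia.
have := hi; rewrite inE => /levelP[/(_ x) + _].
have [M [N [hM M1 nN hf]]] := pow_lower (h n (esym En)).
rewrite hM; move: (ureach e P x v) (uexc e P v) (2 ^ j.+1) => q s J.
case: n => [|n] in nN En h *; nia.
Qed.

(** The clients are charged to the lowest level. On each higher level [x] and a contributor other
    than [x] are two neighbours that are not children. *)
Lemma load_big : 1 < nunits e P v -> load v <= d * #|levels v| + 2.
Proof.
move=> r2; have [j hj hlev] := big_index.
rewrite /load (bigD1 j) //= (cardsD1 j) hj.
have vj : level e P v j.+1 by move: hj; rewrite inE.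
have : #|children e P v j| + #|clients e P v| <= d.+2.
  apply: leq_trans (children_bound vj); rewrite leq_add2l.
  by apply/subset_leq_card/subsetUr.
have : \sum_(i in levels v | i != j) #|children e P v i| <= #|levels v :\ j| * d.
  rewrite -sum_nat_const [leqRHS](eq_bigl (fun i => (i \in levels v) && (i != j))).
    apply: leq_sum => i /andP[hi ij]; have vi : level e P v i.+1 by move: hi; rewrite inE.
    have := children_bound vi.
    (* No level of [v] lies below [j.+1], because [ureach x v] is [2 ^ j.+1 - 1]. *)
    have lei : lev P x <= i.+1.
      rewrite hlev ltnS ltn_neqAle eq_sym ij /= leqNgt; apply/negP => lt.
      have := client2_uexc sym_e irr_e xv big; have := client_ureach sym_e irr_e xv.
      case/levelP: vi => /(_ x) + _; rewrite hlev /=.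
      have : 2 ^ i.+1 < 2 ^ j.+1 by rewrite ltn_exp2l.
      lia.
    have [y hy yx] := client2_contributor irr_e xv big vi lei.
    suff : 2 <= #|contributors e P v i.+1 :|: clients e P v| by lia.
    have <- : #|[set x; y]| = 2 by rewrite cards2 eq_sym yx.
    apply: subset_leq_card; apply/subsetP => z /set2P[]->; rewrite in_setU.
      by rewrite xv orbT.
    by rewrite hy.
  by move=> i; rewrite in_setD1 andbC.
by move=> h1 h2; rewrite addnAC; apply: leq_trans (leq_add h2 h1) _; nia.
Qed.

(** Only the unit of [x] reaches [v], so [v] is empty and each level has two contributors or is
    single. On level [j.+1] two contributors include one that is not a client: a second big client
    would give a second unit reaching [v], and a small one cannot contribute there. *)
Lemma load_big1 : nunits e P v = 1 ->
  load v <= d * #|levels v| + 1 + \sum_(i in levels v) single e P v i.+1.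
Proof.
move=> r1; have [j hj hlev] := big_index.
have ux := client2_ureach_gt0 sym_e irr_e xv big.
have Pv : P v = 0.
  rewrite -(ureach_self e P) (@nunits1 _ _ _ v x) ?r1 //.
  exact: (client_neq irr_e xv).
rewrite /load (bigD1 j) //= [in leqRHS](bigD1 j) //= (cardsD1 j) hj.
have vj : level e P v j.+1 by move: hj; rewrite inE.
have : #|children e P v j| + #|clients e P v| <= d.+1 + single e P v j.+1.
  have := children_bound vj; have := contributors_gt0 vj.
  rewrite /single vj Pv eqxx /=; case: eqP => [_ _|K1 K0] h.
    apply: leq_trans (_ : d.+2 <= _); last lia.
    apply: leq_trans h; rewrite leq_add2l.
    by apply/subset_leq_card/subsetUr.
  suff : #|clients e P v| < #|contributors e P v j.+1 :|: clients e P v| by lia.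
  apply: proper_card; rewrite properE subsetUr /=; apply/subsetP => sub.
  have {}sub y : y \in contributors e P v j.+1 -> y \in clients e P v.
    by move=> hy; apply: sub; rewrite in_setU hy.
  have [y hy yx] : exists2 y, y \in contributors e P v j.+1 & y != x.
    case: (boolP [exists y in contributors e P v j.+1, y != x]) => [/existsP[y /andP[]]|hn].
      by exists y.
    suff : #|contributors e P v j.+1| <= 1 by lia.
    rewrite -(cards1 x); apply: subset_leq_card; apply/subsetP => y hy; rewrite in_set1.
    by move: hn => /existsPn/(_ y); rewrite hy negbK.
  have yv := sub _ hy.
  case: (eqVneq (lev P y) 1) => [levy|bigy].
    have [v1 hn] := client1_level sym_e irr_e yv levy.
    suff j0 : (j : nat) = 0 by rewrite j0 in hy; rewrite hy in hn.
    have := client2_uexc sym_e irr_e xv big; have := client_ureach sym_e irr_e xv.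
    case/levelP: v1 => /(_ x) + _; rewrite hlev /= ?(expnS 2 j) ?expn1.
    by have := leq_expn2 j; lia.
  have := client2_ureach_gt0 sym_e irr_e yv bigy.
  by rewrite (@nunits1 _ _ _ v x y) ?r1.
have : \sum_(i in levels v | i != j) #|children e P v i| <=
       #|levels v :\ j| * d + \sum_(i in levels v | i != j) single e P v i.+1.
  rewrite -sum_nat_const [X in _ <= X + _](eq_bigl (fun i => (i \in levels v) && (i != j))).
    rewrite -big_split; apply: leq_sum => i /andP[hi ij] /=.
    have vi : level e P v i.+1 by move: hi; rewrite inE.
    have := children_bound vi; have := contributors_gt0 vi.
    have : #|contributors e P v i.+1| <= #|contributors e P v i.+1 :|: clients e P v|.
      by apply/subset_leq_card/subsetUl.
    rewrite /single vi Pv eqxx /=; case: eqP => /=; lia.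
  by move=> i; rewrite in_setD1 andbC.
move=> h1 h2; rewrite addnAC; apply: leq_trans (leq_add h2 h1) _.
set S := (X in _ + (_ + X) <= _); rewrite -/S /= add1n mulnS [in leqLHS]mulnC.
move: S (single e P v j.+1 : nat) #|_| => S b c. lia.
Qed.

End BigClient.

Lemma vertex_balanced v : 0 < reach e P v -> balanced v.
Proof.
move=> f0; case: (boolP (small_clients v)) => [small|].
  case: (ltngtP (nunits e P v) 1) => [h|h|h].
  - by apply: balanced_small0 => //; lia.
  - exact: balanced_small2.
  - exact: balanced_small1.
rewrite negb_forall => /existsP[x]; rewrite negb_imply => /andP[xv big].
have room := big_room xv big.
have r0 := nunits_pos (client2_ureach_gt0 sym_e irr_e xv big).
case: (ltngtP (nunits e P v) 1) => [|h|h]; first lia.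
  by apply: (balanced_suff (load_big xv big h) f0 room); lia.
have := load_big1 xv big h; rewrite -addnA => hl.
apply: (balanced_suff hl f0 room); rewrite /demand; lia.
Qed.

(** Summing [balanced] over all vertices cancels loads against demands. *)
Lemma solvable_bound : solvable e P ->
  #|T| + d * (\sum_w TE e (restr P [:: w])) <=
  d * TE e P + \sum_w cov e (restr P [:: w]).
Proof.
move=> solv.
have f0 v : 0 < reach e P v by apply/reachP; exact: (kreachable_flow (solv v)).
have hs : \sum_v (load v + 1 + d * uexc e P v) <=
  \sum_v (d * (reach e P v).-1 + nunits e P v + demand v).
  by apply: leq_sum => v _; exact: vertex_balanced.
have hl : \sum_v (load v + 1 + d * uexc e P v) =
          \sum_v load v + #|T| + d * \sum_v uexc e P v.
  by rewrite 2!big_split /= sum1_card big_distrr.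
have hr : \sum_v (d * (reach e P v).-1 + nunits e P v + demand v) =
          d * \sum_v (reach e P v).-1 + \sum_v nunits e P v + \sum_v demand v.
  by rewrite 2!big_split /= big_distrr.
rewrite {}hl {}hr sum_load in hs.
have -> : \sum_w TE e (restr P [:: w]) = \sum_v uexc e P v.
  rewrite /TE /uexc exchange_big; apply: eq_bigr => v _; apply: eq_bigr => w _.
  by rewrite exc_reach.
have -> : TE e P = \sum_v (reach e P v).-1.
  by apply: eq_bigr => v _; rewrite exc_reach.
have -> : \sum_w cov e (restr P [:: w]) = \sum_v nunits e P v.
  by rewrite /nunits exchange_big; apply: eq_bigr => w _; rewrite covE.
lia.
Qed.

End Balance.

(** * Telescoping *)

Lemma take1_drop (T : eqType) (x0 : T) (s : seq T) i : i < size s ->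
  take 1 (drop i s) = [:: nth x0 s i].
Proof. by move=> h; rewrite (drop_nth x0 h) /= take0. Qed.

Lemma sum_take1_drop (T : eqType) (F : seq T -> nat) (s : seq T) :
  \sum_(i < size s) F (take 1 (drop i s)) = \sum_(x <- s) F [:: x].
Proof.
case: s => [|x0 s]; first by rewrite big_ord0 big_nil.
rewrite (big_nth x0) big_mkord; apply: eq_bigr => i _.
by rewrite (take1_drop x0).
Qed.

Lemma dadd_restr_take (T : finType) (P : dist T) (s : seq T) i : uniq s -> i < size s ->
  dadd (restr P (take i s)) (restr P (take 1 (drop i s))) = restr P (take i.+1 s).
Proof.
move=> us lt; apply: functional_extensionality => v.
have x0 : T by case: (s) lt.
rewrite (take1_drop x0 lt) /dadd /restr (take_nth x0 lt) mem_rcons !inE.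
have : nth x0 s i \notin take i s.
  have := take_uniq i.+1 us; rewrite (take_nth x0 lt) rcons_uniq.
  by case/andP.
by case: eqVneq => [->|_]; [move/negPf->; rewrite add0n | rewrite addn0].
Qed.

Section Occupied.
Variables (T : finType) (e : rel T) (P : dist T) (s : seq T).
Hypotheses (us : uniq s) (occ : forall v, (v \in s) = (0 < P v)).

Lemma restr_occupied : restr P s = P.
Proof.
apply: functional_extensionality => v; rewrite /restr occ.
by case: (P v).
Qed.

Lemma reach_unoccupied w v : w \notin s -> reach e (restr P [:: w]) v = 0.
Proof.
rewrite occ -leqNgt => h; apply/eqP; rewrite -leqn0.
exact: leq_trans (ureach_le e P w v) h.
Qed.

Lemma reach_nil v : reach e (restr P [::]) v = 0.
Proof.
have := reach_le_dsize e (restr P [::]) v.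
by rewrite /dsize /restr big1 //; lia.
Qed.

(** Unoccupied vertices give empty units, so sums along [s] become sums over all vertices. *)
Lemma sum_units (F : dist T -> nat) :
  (forall w, w \notin s -> F (restr P [:: w]) = 0) ->
  \sum_(i < size s) F (restr P (take 1 (drop i s))) = \sum_w F (restr P [:: w]).
Proof.
move=> F0; rewrite (sum_take1_drop (fun t => F (restr P t))) big_uniq //=.
rewrite big_mkcond; apply: eq_bigr => w _.
by case: ifP => // /negbT/F0.
Qed.

Lemma sum_cov_units :
  \sum_(i < size s) cov e (restr P (take 1 (drop i s))) =
  \sum_w cov e (restr P [:: w]).
Proof.
apply: (sum_units (F := cov e)) => w hw; rewrite covE big1 // => v _.
by rewrite reach_unoccupied.
Qed.

Lemma sum_TE_units :
  \sum_(i < size s) TE e (restr P (take 1 (drop i s))) =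
  \sum_w TE e (restr P [:: w]).
Proof.
apply: (sum_units (F := TE e)) => w hw; rewrite /TE big1 // => v _.
by rewrite exc_reach reach_unoccupied.
Qed.

Local Open Scope ring_scope.

Lemma sum_CE :
  \sum_(i < size s) CE e (restr P (take i s)) (restr P (take 1 (drop i s))) =
  (TE e P)%:Z - (\sum_w TE e (restr P [:: w]))%N%:Z.
Proof.
pose F i : int := (TE e (restr P (take i s)))%:Z.
have -> : (TE e P)%:Z = F (size s) - F 0%N.
  rewrite /F take_size restr_occupied take0 [X in _ - X%:Z]/TE big1 ?subr0 // => v _.
  by rewrite exc_reach reach_nil.
rewrite -(telescope_sumr F (leq0n _)) big_mkord -sum_TE_units.
rewrite (big_morph Posz PoszD (erefl _)) -sumrB; apply: eq_bigr => i _.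
by rewrite /CE dadd_restr_take.
Qed.

End Occupied.

Local Open Scope ring_scope.

(* s = [:: x_1; ...; x_t] lists the occupied vertices of P, ordered so that
   |U_i| = P x_i is nondecreasing; U_i = restr P [:: x_i] = restr P (take 1 (drop i s)),
   and U_1 + ... + U_(i-1) = restr P (take i s). *)
Theorem theorem5p1 (T : finType) (e : rel T) (P : dist T) (s : seq T) :
  simple_graph e ->
  (3 <= maxdeg e)%N ->
  solvable e P ->
  uniq s ->
  (forall v, (v \in s) = (0 < P v)%N) ->
  sorted (fun x y => P x <= P y)%N s ->
  ((\sum_(i < size s) CE e (restr P (take i s)) (restr P (take 1 (drop i s))))%:~R : rat)
    >= ((#|T|%:Z - (\sum_(i < size s) cov e (restr P (take 1 (drop i s))))%:Z)%:~R : rat)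
       / ((maxdeg e)%:R - 2).
Proof.
case=> sym_e irr_e deg3 solv us occ _.
have [d dE] : exists d, maxdeg e = d.+2 by exists (maxdeg e).-2; lia.
have d_gt0 : (0 < d)%N by lia.
have := solvable_bound sym_e irr_e d_gt0 dE solv.
rewrite (sum_cov_units e us occ) (sum_CE e us occ).
move: (TE e P) (\sum_w TE _ _)%N (\sum_w cov _ _)%N => a b c h.
have -> : (maxdeg e)%:R - 2 = d%:R :> rat by rewrite dE -addn2 natrD addrK.
rewrite ler_pdivrMr ?ltr0n // -[d%:R]/((d%:Z)%:~R) -intrM ler_int; lia.
Qed.
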